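(* Let $0\neq A\in\mathbb{R}^{m\times n}$ and $b\in\mathbb{R}^m$ with $Ax=b$ consistent, let $B\in\mathbb{R}^{n\times n}$ be symmetric positive definite and $c\in\mathbb{R}^n$. Let $\mathcal{D}$ be a distribution over random matrices $S$ with $m$ rows such that $$H=\mathbf{E}_{S\sim\mathcal{D}}\left[S\left(S^\top AB^{-1}A^\top S\right)^\dagger S^\top\right]$$ is well defined and nonsingular. Fix arbitrary $y^0\in\mathbb{R}^m$, let $$y^{k+1}=y^k+S\left(S^\top AB^{-1}A^\top S\right)^\dagger S^\top\left(b-A(c+B^{-1}A^\top y^k)\right),$$ where in each iteration $S\sim\mathcal{D}$ is drawn independently, and let $x^k=c+B^{-1}A^\top y^k$. Let $x^*$ be the minimizer of $P$ over $\{x: Ax=b\}$, let $y^*$ be a maximizer of $D$ over $\mathbb{R}^m$, $OPT=P(x^* )=D(y^* )$, and $$U_0=\tfrac12\|x^0-x^*\|_B^2=OPT-D(y^0),\qquad \rho=1-\lambda_{\min}^+\left(B^{-1/2}A^\top HAB^{-1/2}\right).$$ Then for all $k\ge0$: $$\mathbf{E}[OPT-D(y^k)]\le\rho^kU_0,$$ $$\mathbf{E}[P(x^k)-OPT]\le\rho^kU_0+2\rho^{k/2}\sqrt{OPT\times U_0},$$ $$\mathbf{E}[P(x^k)-D(y^k)]\le2\rho^kU_0+2\rho^{k/2}\sqrt{OPT\times U_0}.$$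
   Context: $P(x)=\tfrac12\|x-c\|_B^2$ for $x\in\mathbb{R}^n$ is the primal objective (to be minimized subject to $Ax=b$) and $D(y)=(b-Ac)^\top y-\tfrac12\|A^\top y\|_{B^{-1}}^2$ for $y\in\mathbb{R}^m$ is the dual objective (to be maximized without constraints). For symmetric positive definite $G$, $\|x\|_G=\sqrt{x^\top Gx}$. $\lambda^+_{\min}(M)$ is the smallest nonzero eigenvalue of a nonzero symmetric positive semidefinite matrix $M$; $\dagger$ is the Moore–Penrose pseudoinverse; $B^{-1/2}$ is the symmetric positive definite square root of $B^{-1}$. The number of columns of $S$ may be random. The starting point $y^0$ is deterministic. *)

(* Defs.v *)
From HB Require Import structures.
From mathcomp Require Import all_boot all_order all_algebra.
From mathcomp Require Import all_classical all_reals all_analysis.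

Set Implicit Arguments.
Unset Strict Implicit.
Unset Printing Implicit Defensive.
Import Order.TTheory GRing.Theory Num.Theory.
Import numFieldNormedType.Exports.
Local Open Scope classical_set_scope.
Local Open Scope ring_scope.

(* MathComp-Analysis world; vectors of R^n are columns 'cV[R]_n. *)

Definition spd (R : realType) (n : nat) (G : 'M[R]_n) : Prop :=
  G^T = G /\ forall x : 'cV[R]_n, x != 0 -> 0 < (x^T *m G *m x) 0 0.

Definition normG (R : realType) (n : nat) (G : 'M[R]_n) (x : 'cV[R]_n) : R :=
  Num.sqrt ((x^T *m G *m x) 0 0).

Definition spd_sqrt (R : realType) (n : nat) (G Q : 'M[R]_n) : Prop :=
  spd Q /\ Q *m Q = G.

(* The spectrum is finite, so for a nonzero symmetric positive semidefinite M
   this infimum is the smallest nonzero eigenvalue. *)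
Definition lambda_min_pos (R : realType) (n : nat) (M : 'M[R]_n) : R :=
  inf [set l : R | eigenvalue M l /\ l <> 0].

Definition penrose (R : realType) (m n : nat)
    (M : 'M[R]_(m, n)) (X : 'M[R]_(n, m)) : Prop :=
  [/\ M *m X *m M = M, X *m M *m X = X,
      (M *m X)^T = M *m X & (X *m M)^T = X *m M].

(* Moore-Penrose pseudoinverse; MathComp's pinvmx is only some generalized
   inverse. Existence and uniqueness are mpinvP and penrose_uniq below, so the
   default value 0 is never used. *)
Definition mpinv (R : realType) (m n : nat) (M : 'M[R]_(m, n)) : 'M[R]_(n, m) :=
  xget 0 [set X | penrose M X].

Lemma gram_unit (R : realType) (r n : nat) (F : 'M[R]_(r, n)) :
  row_free F -> F *m F^T \in unitmx.
Proof.
move=> Ffree; rewrite -row_free_unit; apply/row_freeP; exists (invmx (F *m F^T)).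
apply: mulmxV; rewrite -row_free_unit -kermx_eq0; apply/eqP/row_matrixP => i.
rewrite row0; set u := row i _.
have /eqP uFF : u *m (F *m F^T) == 0 by rewrite -sub_kermx row_sub.
suff uF0 : u *m F = 0.
  by apply/eqP; move/eqP: uF0; rewrite mulmx_free_eq0.
have : (u *m F *m (u *m F)^T) 0 0 = 0.
  by rewrite trmx_mul mulmxA -(mulmxA u) uFF mul0mx mxE.
rewrite mxE => /eqP; rewrite psumr_eq0 => [/allP h|j _].
  apply/rowP => j; rewrite [RHS]mxE; apply/eqP.
  by have := h j (mem_index_enum _); rewrite [X in _ * X]mxE mulf_eq0 orbb.
by rewrite [X in _ * X]mxE -expr2 sqr_ge0.
Qed.

Lemma penrose_uniq (R : realType) (m n : nat) (M : 'M[R]_(m, n))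
    (X Y : 'M[R]_(n, m)) : penrose M X -> penrose M Y -> X = Y.
Proof.
move=> [x1 x2 x3 x4] [y1 y2 y3 y4].
have MXY : M *m X = M *m Y.
  by rewrite -{1}y1 -mulmxA -x3 -y3 -trmx_mul !mulmxA x1.
have XMY : X *m M = Y *m M.
  by rewrite -{1}y1 2!mulmxA -(mulmxA (X *m M)) -x4 -y4 -trmx_mul -!mulmxA (mulmxA M X) x1.
by rewrite -x2 XMY -mulmxA MXY mulmxA y2.
Qed.

Lemma mpinvP (R : realType) (m n : nat) (M : 'M[R]_(m, n)) :
  penrose M (mpinv M).
Proof.
have [X pX] : exists X, penrose M X.
  have [r [C [F [-> Cfull Ffree]]]] :
      exists r (C : 'M[R]_(m, r)) (F : 'M[R]_(r, n)),
      [/\ M = C *m F, row_full C & row_free F].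
    exists (\rank M), (col_base M), (row_base M).
    by rewrite mulmx_base row_base_free col_base_full.
  have Fu : F *m F^T \in unitmx by exact: gram_unit.
  have Cu : C^T *m C \in unitmx.
    rewrite -{2}[C]trmxK; apply: gram_unit.
    by move: Cfull; rewrite /row_full /row_free mxrank_tr.
  pose Fi := F^T *m invmx (F *m F^T); pose Ci := invmx (C^T *m C) *m C^T.
  have FFi : F *m Fi = 1%:M by rewrite /Fi mulmxA mulmxV.
  have CiC : Ci *m C = 1%:M by rewrite /Ci -mulmxA mulVmx.
  have MX : C *m F *m (Fi *m Ci) = C *m Ci.
    by rewrite mulmxA -(mulmxA C) FFi mulmx1.
  have XM : Fi *m Ci *m (C *m F) = Fi *m F.
    by rewrite mulmxA -(mulmxA Fi) CiC mulmx1.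
  exists (Fi *m Ci); split.
  - by rewrite MX mulmxA -(mulmxA C) CiC mulmx1.
  - by rewrite XM mulmxA -(mulmxA Fi) FFi mulmx1.
  - by rewrite MX /Ci !trmx_mul trmx_inv !trmx_mul !trmxK mulmxA.
  - by rewrite XM /Fi !trmx_mul trmx_inv !trmx_mul !trmxK mulmxA.
by rewrite /mpinv; case: xgetP => [Y -> //|/(_ X)].
Qed.

(* Matrices with m rows and an arbitrary (hence possibly random) number q of
   columns. *)
Definition rows_mx (R : realType) (m : nat) : Type := {q : nat & 'M[R]_(m, q)}.

HB.instance Definition _ (R : realType) (m : nat) := Choice.on (rows_mx R m).
HB.instance Definition _ (R : realType) (m : nat) :=
  isPointed.Build (rows_mx R m)
    (existT (fun q => 'M[R]_(m, q)) 0%N 0).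

(* Generators of the Borel sigma-algebra of the disjoint union of the spaces
   R^(m x q): the q-th component, and its Borel cylinders. *)
Definition rows_mx_gen (R : realType) (m : nat) : set_system (rows_mx R m) :=
  [set X | exists q : nat, X = [set s | tag s = q]] `|`
  [set X | exists (q : nat) (i : 'I_m) (j : 'I_q) (E : set R),
     measurable E /\
     X = [set existT (fun p => 'M[R]_(m, p)) q M
            | M in [set M : 'M[R]_(m, q) | E (M i j)]]].

Definition rmat (R : realType) (m : nat) := g_sigma_algebraType (@rows_mx_gen R m).

Definition indep_family (d d' : measure_display) (T : measurableType d)
    (T' : measurableType d') (R : realType) (P : probability T R)
    (X : nat -> {RV P >-> T'}) : Prop :=
  forall (s : seq nat) (E : nat -> set T'),
    uniq s -> (forall k, measurable (E k)) ->
    P (\bigcap_(k in [set` s]) (X k @^-1` E k)) =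
    (\prod_(k <- s) P (X k @^-1` E k))%E.

Definition iid (d d' : measure_display) (T : measurableType d)
    (T' : measurableType d') (R : realType) (P : probability T R)
    (D : probability T' R) (X : nat -> {RV P >-> T'}) : Prop :=
  (forall k (E : set T'), measurable E -> distribution P (X k) E = D E) /\
  indep_family X.

Definition sketch (R : realType) (m n : nat) (A : 'M[R]_(m, n)) (B : 'M[R]_n)
    (s : rows_mx R m) : 'M[R]_m :=
  let S := tagged s in
  S *m mpinv (S^T *m A *m invmx B *m A^T *m S) *m S^T.

Definition sketch_integrable (R : realType) (m n : nat) (A : 'M[R]_(m, n))
    (B : 'M[R]_n) (D : probability (rmat R m) R) : Prop :=
  forall i j : 'I_m, D.-integrable setT (fun s => (sketch A B s i j)%:E).

Definition meanH (R : realType) (m n : nat) (A : 'M[R]_(m, n)) (B : 'M[R]_n)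
    (D : probability (rmat R m) R) : 'M[R]_m :=
  \matrix_(i, j) fine ('E_D[fun s => sketch A B s i j])%E.

Definition primal (R : realType) (n : nat) (B : 'M[R]_n) (c x : 'cV[R]_n) : R :=
  2^-1 * normG B (x - c) ^+ 2.

Definition dual (R : realType) (m n : nat) (A : 'M[R]_(m, n)) (b : 'cV[R]_m)
    (B : 'M[R]_n) (c : 'cV[R]_n) (y : 'cV[R]_m) : R :=
  ((b - A *m c)^T *m y) 0 0 - 2^-1 * normG (invmx B) (A^T *m y) ^+ 2.

Definition primal_of (R : realType) (m n : nat) (A : 'M[R]_(m, n))
    (B : 'M[R]_n) (c : 'cV[R]_n) (y : 'cV[R]_m) : 'cV[R]_n :=
  c + invmx B *m A^T *m y.

Fixpoint sda (R : realType) (m n : nat) (A : 'M[R]_(m, n)) (b : 'cV[R]_m)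
    (B : 'M[R]_n) (c : 'cV[R]_n) (y0 : 'cV[R]_m) (S : nat -> rows_mx R m)
    (k : nat) : 'cV[R]_m :=
  if k is k'.+1 then
    let y := sda A b B c y0 S k' in
    y + sketch A B (S k') *m (b - A *m primal_of A B c y)
  else y0.

(* Main.v *)
(* Let W = B^(-1/2) A^T, so that A B^(-1) A^T = W^T W. Stationarity of D at ys
   gives b - A c = W^T W ys, hence xs = c + B^(-1) A^T ys, and with
   e_k = W (y^k - ys) one finds OPT - D(y^k) = |e_k|^2 / 2 and
   P(x^k) - OPT = |e_k|^2 / 2 + <e_k, W ys>. If Z denotes the random sketching
   matrix, then Z (W^T W) Z = Z, so W Z W^T is an orthogonal projection, and
   e_(k+1) = (I - W Z W^T) e_k yields
   |e_(k+1)|^2 = |e_k|^2 - e_k^T W Z W^T e_k. By independence the mean of the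
   last term is that of e_k^T (W H W^T) e_k, which is at least
   lambda_min^+ |e_k|^2 because e_k lies in the range of W, i.e. that of
   W H W^T. The cross term <e_k, W ys> is bounded by Cauchy-Schwarz in L^2. *)
Require Import Defs.
From HB Require Import structures.
From mathcomp Require Import all_boot all_order all_algebra.
From mathcomp Require Import all_classical all_reals all_analysis.
From mathcomp Require Import measurable_realfun complex zify ring lra.

Set Implicit Arguments.
Unset Strict Implicit.
Unset Printing Implicit Defensive.
Import Order.TTheory GRing.Theory Num.Theory.
Import numFieldNormedType.Exports.
Local Open Scope classical_set_scope.
Local Open Scope ring_scope.

(** * The Euclidean inner product on column vectors *)

Definition vdot (R : realType) (n : nat) (x y : 'cV[R]_n) : R :=
  (x^T *m y) 0 0.

Section Vdot.
Variables (R : realType) (n : nat).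
Implicit Types x y z : 'cV[R]_n.

Lemma vdotE x y : vdot x y = \sum_i x i 0 * y i 0.
Proof. by rewrite /vdot mxE; apply: eq_bigr => i _; rewrite mxE. Qed.

Lemma vdotC x y : vdot x y = vdot y x.
Proof. by rewrite !vdotE; apply: eq_bigr => i _; rewrite mulrC. Qed.

Lemma vdotDr x y z : vdot x (y + z) = vdot x y + vdot x z.
Proof. by rewrite /vdot mulmxDr mxE. Qed.

Lemma vdotNr x y : vdot x (- y) = - vdot x y.
Proof. by rewrite /vdot mulmxN mxE. Qed.

Lemma vdotZr a x y : vdot x (a *: y) = a * vdot x y.
Proof. by rewrite /vdot -scalemxAr mxE. Qed.

Lemma vdotDl x y z : vdot (x + y) z = vdot x z + vdot y z.
Proof. by rewrite vdotC vdotDr !(vdotC z). Qed.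

Lemma vdotNl x y : vdot (- x) y = - vdot x y.
Proof. by rewrite vdotC vdotNr vdotC. Qed.

Lemma vdotZl a x y : vdot (a *: x) y = a * vdot x y.
Proof. by rewrite vdotC vdotZr vdotC. Qed.

Lemma vdot_ge0 x : 0 <= vdot x x.
Proof. by rewrite vdotE sumr_ge0// => i _; rewrite -expr2 sqr_ge0. Qed.

Lemma vdot_eq0 x : vdot x x = 0 -> x = 0.
Proof.
rewrite vdotE => /eqP; rewrite psumr_eq0 => [/allP h|i _]; last first.
  by rewrite -expr2 sqr_ge0.
apply/colP => i; rewrite mxE; apply/eqP.
by have := h i (mem_index_enum _); rewrite mulf_eq0 orbb.
Qed.

Lemma vdot_mulr m (M : 'M[R]_(n, m)) x (y : 'cV[R]_m) :
  vdot x (M *m y) = vdot (M^T *m x) y.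
Proof. by rewrite /vdot trmx_mul trmxK mulmxA. Qed.

End Vdot.

(** * Positive semidefinite matrices: stationarity, kernel and spectrum *)

Definition psd (R : realType) (n : nat) (K : 'M[R]_n) : Prop :=
  K^T = K /\ forall x : 'cV[R]_n, 0 <= vdot x (K *m x).

(** Moving from [y] by [t] times the gradient [g = h - M y] cannot raise the value, so
    [t |g|^2 <= t^2/2 * g^T M g] for every [t]. For small positive [t] this fails unless [g = 0]. *)
Lemma maximizer_stationary (R : realType) (m : nat) (M : 'M[R]_m)
    (h y : 'cV[R]_m) :
  psd M ->
  (forall x, vdot h x - 2^-1 * vdot x (M *m x) <=
             vdot h y - 2^-1 * vdot y (M *m y)) ->
  h = M *m y.
Proof.
move=> [Msym Mge0] ymax; apply/eqP; rewrite -subr_eq0; apply/eqP.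
move gE : (h - M *m y) => g; apply: vdot_eq0.
have key t : t * vdot g g <= 2^-1 * t ^+ 2 * vdot g (M *m g).
  have := ymax (y + t *: g).
  rewrite mulmxDr -scalemxAr !(vdotDr, vdotDl, vdotZl, vdotZr).
  rewrite (vdot_mulr M y g) Msym (vdotC g (M *m y)).
  have -> : vdot g g = vdot h g - vdot (M *m y) g.
    by rewrite -{1}gE vdotDl vdotNl.
  by lra.
apply/eqP; rewrite eq_le vdot_ge0 andbT leNgt; apply/negP => g0.
have q0 := Mge0 g; set a := vdot g g in key g0; set q := vdot _ _ in key q0.
have q1 : 0 < q + 1 by rewrite ltr_wpDl.
(* The [+ 1] keeps the step length defined when [q = 0]. With this [t] one has [t q < a], so the
   quadratic term cannot make up for the linear one. *)
have := key (a / (q + 1)); rewrite leNgt => /negP; apply.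
set t := a / (q + 1); have t0 : 0 < t by rewrite divr_gt0.
have tq : t * q + t = a by rewrite -{2}[t]mulr1 -mulrDr divfK ?gt_eqF.
rewrite -mulrA mulrCA expr2 -mulrA ltr_pM2l//.
by clearbody t; nra.
Qed.

(** A zero of the quadratic form minimizes it, so stationarity with zero linear term applies. *)
Lemma psd_ker (R : realType) (n : nat) (K : 'M[R]_n) (x : 'cV[R]_n) :
  psd K -> vdot x (K *m x) = 0 -> K *m x = 0.
Proof.
move=> Kpsd Kx0; symmetry; apply: maximizer_stationary => // y.
rewrite Kx0 /vdot trmx0 !mul0mx mxE mulr0 lerD2l lerN2.
by rewrite mulr_ge0// (proj2 Kpsd).
Qed.

Lemma psd_eigenvalue_ge0 (R : realType) (n : nat) (K : 'M[R]_n) (l : R) :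
  psd K -> eigenvalue K l -> 0 <= l.
Proof.
move=> [Ksym Kge0] /eigenvalueP [v vK v0].
have : 0 <= l * vdot v^T v^T.
  have := Kge0 v^T; rewrite -{1}Ksym -trmx_mul vK.
  by rewrite linearZ /= vdotZr.
rewrite pmulr_lge0// lt_neqAle vdot_ge0 andbT eq_sym.
apply: contra v0 => /eqP /vdot_eq0 v0.
by rewrite -[v]trmxK v0 trmx0.
Qed.

(** [inf] is a lower bound only for a set that is bounded below; semidefiniteness supplies the bound
    0. *)
Lemma lambda_min_pos_le (R : realType) (n : nat) (K : 'M[R]_n) (l : R) :
  psd K -> eigenvalue K l -> l != 0 -> lambda_min_pos K <= l.
Proof.
move=> Kpsd Kl /eqP l0; apply: ge_inf => //.
by exists 0 => x [/(psd_eigenvalue_ge0 Kpsd)].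
Qed.

(** * Rayleigh bound on the range of a semidefinite matrix *)

Section Rayleigh.
Local Open Scope sesquilinear_scope.

(* K is diagonalized over R[i]; x has no component along the kernel of K since
   it lies in the range of K. *)
Lemma lambda_min_pos_rayleigh (R : realType) (n : nat) (K : 'M[R]_n)
    (x z : 'cV[R]_n) :
  psd K -> x = K *m z ->
  lambda_min_pos K * vdot x x <= vdot x (K *m x).
Proof.
move=> Kpsd xz; have [Ksym Kge0] := Kpsd.
pose f := real_complex R.
pose Kc := map_mx f K; pose xc := map_mx f x; pose zc := map_mx f z.
have fconj a : (f a)^* = f a by exact: conjc_real.
have Kcherm : Kc \is hermsymmx.
  apply/is_hermitianmxP; rewrite expr0 scale1r; apply/matrixP => i j.
  by rewrite !mxE fconj -{1}Ksym mxE.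
have /orthomx_spectralP := hermitian_normalmx Kcherm.
have lreal := hermitian_spectral_diag_real Kcherm.
have Puni := spectral_unitarymx Kc.
move: (spectralmx Kc) (spectral_diag Kc) Puni lreal => P sp Puni lreal KcE.
have PK : P *m Kc = diag_mx sp *m P.
  by rewrite KcE !mulmxA mulmxV ?mul1mx// unitarymx_unit.
pose u := P *m xc.
(* Because [x = K z], each eigencoordinate of [x] carries its eigenvalue as a factor. Coordinates
   with eigenvalue 0 therefore vanish, and only nonzero eigenvalues have to be compared with the
   minimum. *)
have uE i : u i 0 = sp 0 i * (P *m zc) i 0.
  rewrite /u /xc xz map_mxM -/Kc -/zc mulmxA PK -mulmxA mul_diag_mx.
  by rewrite mxE.
have xcT (w : 'cV[R]_n) : (map_mx f w)^T = (map_mx f w) ^t*.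
  by apply/matrixP => i j; rewrite !mxE fconj.
have fvdot (v w : 'cV[R]_n) : f (vdot v w) = ((map_mx f v)^T *m map_mx f w) 0 0.
  by rewrite map_trmx -map_mxM [RHS]mxE.
have unitE : P ^t* *m P = 1%:M.
  by rewrite -invmx_unitary// mulVmx// unitarymx_unit.
have utE : u ^t* = xc ^t* *m P ^t* by rewrite /u trmx_mul map_mxM.
have hxx : f (vdot x x) = \sum_i `|u i 0| ^+ 2.
  rewrite fvdot xcT -/xc -[X in _ *m X]mul1mx -unitE -mulmxA mulmxA -utE mxE.
  by apply: eq_bigr => i _; rewrite !mxE normCK mulrC.
have hxKx : f (vdot x (K *m x)) = \sum_i sp 0 i * `|u i 0| ^+ 2.
  rewrite fvdot xcT -/xc map_mxM -/Kc -/xc KcE invmx_unitary//.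
  rewrite !mulmxA -utE -mulmxA -/u -mulmxA mul_diag_mx mxE; apply: eq_bigr => i _.
  by rewrite !mxE normCK; ring.
rewrite -lecR -[X in X <= _]/(f _) -[X in _ <= X]/(f _).
have -> : f (lambda_min_pos K * vdot x x) = f (lambda_min_pos K) * f (vdot x x).
  exact: (rmorphM (real_complex R)).
rewrite hxKx hxx mulr_sumr; apply: ler_sum => i _.
have [spi0|spi0] := eqVneq (sp 0 i) 0.
  by rewrite uE spi0 !mul0r normr0 expr0n/= mulr0.
rewrite ler_wpM2r ?exprn_ge0//.
have spr : sp 0 i = f (complex.Re (sp 0 i)) by rewrite /f /= RRe_real// (mxOverP lreal).
(* The rows of the unitary [P] are left eigenvectors; they are nonzero since the diagonal entries of
   [P P^*] are 1. *)
have spK : eigenvalue Kc (sp 0 i).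
  apply/eigenvalueP; exists (row i P).
    by rewrite -row_mul PK mul_diag_mx; apply/rowP => j; rewrite !mxE.
  apply/eqP => Pi0; have := oner_neq0 R[i]; apply/negP/negPn/eqP.
  have /matrixP/(_ i i) := unitarymxP Puni.
  rewrite [RHS]mxE eqxx => Pii; rewrite -[1]Pii mxE big1// => j _.
  by have /rowP/(_ j) := Pi0; rewrite !mxE => ->; rewrite mul0r.
rewrite spr /f /= lecR lambda_min_pos_le//.
  by rewrite -(eigenvalue_map (real_complex R)) -[X in eigenvalue _ X]/(f _) -spr.
by apply: contra spi0 => /eqP h; rewrite spr h /f.
Qed.

End Rayleigh.

(** * Independence of each sample from the earlier ones *)

Lemma bounded_rv_integrable (d : measure_display) (R : realType)
    (T : measurableType d) (P : probability T R) (f : T -> R) (C : R) :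
  measurable_fun setT f -> (forall t, `|f t| <= C) ->
  P.-integrable setT (EFin \o f).
Proof.
move=> mf fC; apply: measurable_bounded_integrable => //.
  by rewrite (le_lt_trans (probability_le1 P _)) ?ltry.
exists C; split; first exact: num_real.
by move=> x Cx t _; apply: le_trans (fC t) _; exact: ltW.
Qed.

Section Independence.
Context (d d' : measure_display) (R : realType) (Omega : measurableType d)
  (T : measurableType d') (P : probability Omega R) (D : probability T R)
  (S : nat -> {RV P >-> T}) (hS : iid D S).

(* Generates the sigma-algebra of S_0, ..., S_(k-1). *)
Definition past_cylinders (k : nat) : set_system Omega :=
  [set F | exists E : nat -> set T, (forall i, measurable (E i)) /\
     F = \bigcap_(i in [set` iota 0 k]) (S i @^-1` E i)].

(** [Omega] under a coarser sigma-algebra, so that depending only on the first [k] samples becomes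
    ordinary measurability. *)
Definition past (k : nat) := g_sigma_algebraType (past_cylinders k).

Lemma past_cylinders_measurable k : past_cylinders k `<=` measurable.
Proof.
move=> F [E [mE ->]]; apply: fin_bigcap_measurable => // i _.
exact: measurable_funPTI.
Qed.

Lemma past_measurableW k (phi : Omega -> R) :
  measurable_fun [set: past k] (phi : past k -> R) ->
  measurable_fun [set: Omega] phi.
Proof.
move=> mphi _ B mB; rewrite setTI.
have := mphi measurableT B mB; rewrite setTI.
apply: (smallest_sub (sigma_algebra_measurable _)).
exact: past_cylinders_measurable.
Qed.

(** For fixed [E] both sides are finite measures in [F]. They agree on the cylinders, which are
    stable under intersection, hence on the sigma-algebra these generate. *)
Lemma past_indep_event k (F : set Omega) (E : set T) :
  <<s past_cylinders k >> F -> measurable E ->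
  P (F `&` S k @^-1` E) = (P F * D E)%E.
Proof.
move=> sF mE; have [SD Sind] := hS.
have mC : measurable (S k @^-1` E) by exact: measurable_funPTI.
have DE : D E = (fine (D E))%:E by rewrite fineK// fin_num_measure.
have DE0 : 0 <= fine (D E) by rewrite fine_ge0.
rewrite muleC.
pose m2 := mscale (NngNum DE0) P.
have m2E X : m2 X = (D E * P X)%E by rewrite DE.
rewrite -m2E; apply: (g_sigma_algebra_measure_unique (past_cylinders k)
   (@past_cylinders_measurable k) (fun=> setT) _ _ (mrestr P mC) m2 _ _ _ _ sF).
- by move=> _; exists (fun=> setT); split => //; rewrite bigcapT.
- by rewrite bigcup_const.
- move=> _ _ [E1 [mE1 ->]] [E2 [mE2 ->]].
  exists (fun i => E1 i `&` E2 i); split; first by move=> i; exact: measurableI.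
  by rewrite -bigcapI.
- move=> _ [E1 [mE1 ->]].
  (* Inserting [E] at index [k] turns the intersection into a cylinder over [k :: iota 0 k], to
     which mutual independence applies. *)
  pose E2 i := if i == k then E else E1 i.
  have mE2 i : measurable (E2 i) by rewrite /E2; case: ifP.
  have E12 i : i \in iota 0 k -> E2 i = E1 i.
    by rewrite mem_iota /E2 add0n => /andP[_ ik]; rewrite ltn_eqF.
  have h2 := Sind (k :: iota 0 k) E2; have h1 := Sind (iota 0 k) E1.
  have E2k : E2 k = E by rewrite /E2 eqxx.
  rewrite big_cons E2k in h2.
  rewrite [RHS]m2E -(SD k)// /mrestr [in RHS]/distribution /pushforward.
  rewrite h1 ?iota_uniq//.
  rewrite (eq_big_seq (fun i => P (S i @^-1` E2 i))) => [|i ik]; last first.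
    by rewrite E12.
  rewrite -h2//; last by rewrite /= iota_uniq mem_iota add0n ltnn.
  congr (P _); apply/seteqP; split => w.
    move=> [Ew Ekw] i /=; rewrite inE => /orP[/eqP ->|ik]; first by rewrite E2k.
    by rewrite E12//; exact: Ew.
  move=> Ew; split; last by have /= := Ew k; rewrite E2k mem_head; exact.
  by move=> i /= ik; rewrite -E12//; apply: Ew; rewrite /= inE ik orbT.
- by move=> _; rewrite /mrestr (le_lt_trans (probability_le1 _ _)) ?ltry//; exact: measurableI.
Qed.

(** Independence on rectangles makes the joint law of [(phi, S k)] the product of its marginals, and
    Fubini factors the integral. Boundedness of [phi] makes the product integrable. *)
Lemma past_indep_integral k (phi : Omega -> R) (f : T -> R) (C : R) :
  measurable_fun [set: past k] (phi : past k -> R) ->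
  (forall w, `|phi w| <= C) -> D.-integrable setT (EFin \o f) ->
  P.-integrable setT (fun w => (phi w * f (S k w))%:E) /\
  \int[P]_w (phi w * f (S k w)) = (\int[P]_w phi w) * (\int[D]_t f t).
Proof.
move=> mphi phiC intf; have [SD _] := hS.
have mphi' := past_measurableW mphi.
have phiS := isMeasurableFun.Build _ _ _ _ phi mphi'.
pose Phi : {mfun Omega >-> R} := HB.pack phi phiS.
have mf : measurable_fun setT f by move/integrableP: intf => [/measurable_EFinP].
have mS : measurable_fun setT (S k) by [].
pose J w := (phi w, S k w).
have mJ : measurable_fun setT J by exact: measurable_fun_pair.
pose g (z : R * T) := (z.1 * f z.2)%:E.
have mg : measurable_fun setT g.
  apply/measurable_EFinP; apply: measurable_funM => //.
  by apply: measurableT_comp => //.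
have jointE X : measurable X -> (distribution P Phi \x D)%E X = pushforward P J X.
  apply: product_measure_unique => A B mA mB.
  apply: past_indep_event => //.
  by have := mphi measurableT A mA; rewrite setTI.
have intfS : P.-integrable setT (fun w => (f (S k w))%:E).
  have mfS : measurable_fun setT (fun w => (f (S k w))%:E).
    by apply/measurable_EFinP; exact: measurableT_comp.
  apply/integrableP; split => //.
  have /integrableP[mEf] := intf.
  rewrite (eq_measure_integral (distribution P (S k))) => [|E mE _]; last first.
    by symmetry; exact: SD.
  apply: le_lt_trans; rewrite le_eqVlt; apply/orP; left; apply/eqP; symmetry.
  apply: (ge0_integral_distribution (S k)) => //.
  exact: measurableT_comp.
have intgJ : P.-integrable setT (g \o J).
  apply: (@le_integrable _ _ _ _ _ measurableT _ (fun w => (C%:E * (f (S k w))%:E)%E)).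
  - exact: measurableT_comp.
  - move=> w _; rewrite /g /J /= lee_fin !normrM ler_wpM2r//.
    by rewrite (le_trans (phiC w))// ler_norm.
  - exact: integrableZl.
have intphi : P.-integrable setT (EFin \o phi).
  exact: bounded_rv_integrable mphi' phiC.
have intgp : (pushforward P J).-integrable setT g by exact: integrable_pushforward.
have intg : (distribution P Phi \x D)%E.-integrable setT g.
  apply/integrableP; split => //.
  rewrite (eq_measure_integral (pushforward P J)) => [|E mE _]; last exact: jointE.
  by have /integrableP[] := intgp.
split; first exact: intgJ.
rewrite {1}/Rintegral.
have -> : (\int[P]_w (phi w * f (S k w))%:E = \int[pushforward P J]_z g z)%E.
  by rewrite integral_pushforward.
rewrite (eq_measure_integral (distribution P Phi \x D)%E) => [|E mE _]; last first.
  by symmetry; exact: jointE.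
rewrite -integral12_prod_meas1// /fubini_F /g /=.
have intDf r : (\int[D]_y (r * f y)%:E = (r * \int[D]_t f t)%:E)%E.
  under eq_integral do rewrite EFinM.
  rewrite integralZl// EFinM /Rintegral fineK//.
  by rewrite integrable_fin_num.
under eq_integral do rewrite intDf.
have -> : (\int[distribution P Phi]_x (x * \int[D]_t f t)%:E =
           \int[P]_w (phi w * \int[D]_t f t)%:E)%E.
  apply: (@integral_distribution _ _ _ _ _ P Phi).
    by apply/measurable_EFinP; exact: measurable_funM.
  rewrite [X in _.-integrable _ X](_ : _ =
    (fun w => (phi w)%:E * (\int[D]_t f t)%:E)%E); last by apply/funext.
  exact: integrableZr.
under eq_integral do rewrite EFinM.
by rewrite integralZr// fineM// integrable_fin_num.
Qed.

End Independence.

(** * Algebra of the sketching matrix *)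

(** The transposed pseudoinverse satisfies the Penrose equations of [N^T = N], so uniqueness
    applies. *)
Lemma mpinv_sym (R : realType) (n : nat) (N : 'M[R]_n) :
  N^T = N -> (mpinv N)^T = mpinv N.
Proof.
move=> Nsym; have [h1 h2 h3 h4] := mpinvP N.
apply: (@penrose_uniq _ _ _ N) (mpinvP N); split.
- by apply: trmx_inj; rewrite !trmx_mul trmxK Nsym mulmxA.
- by apply: trmx_inj; rewrite !trmx_mul !trmxK Nsym mulmxA.
- by rewrite trmx_mul trmxK Nsym -h4 trmx_mul Nsym.
- by rewrite trmx_mul trmxK Nsym -h3 trmx_mul Nsym.
Qed.

Section Sketch.
Variables (R : realType) (m n : nat) (A : 'M[R]_(m, n)) (B : 'M[R]_n)
  (W : 'M[R]_(n, m)).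
Hypothesis WE : A *m invmx B *m A^T = W^T *m W.

Lemma sketchE (s : rows_mx R m) :
  sketch A B s = tagged s *m
    mpinv ((tagged s)^T *m (W^T *m W) *m tagged s) *m (tagged s)^T.
Proof. by rewrite /sketch -WE !mulmxA. Qed.

Lemma sketch_sym (s : rows_mx R m) : (sketch A B s)^T = sketch A B s.
Proof.
rewrite sketchE !trmx_mul trmxK mpinv_sym ?mulmxA//.
by rewrite !trmx_mul !trmxK !mulmxA.
Qed.

(** The second Penrose equation, multiplied by the sample on the left and its transpose on the
    right. *)
Lemma sketch_proj (s : rows_mx R m) :
  sketch A B s *m (W^T *m W) *m sketch A B s = sketch A B s.
Proof.
rewrite sketchE; move: (tagged s) => X.
set N := X^T *m _ *m X; have [_ h2 _ _] := mpinvP N.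
transitivity (X *m (mpinv N *m N *m mpinv N) *m X^T); last by rewrite h2.
by rewrite /N !mulmxA.
Qed.

End Sketch.

(** * Expectations as real-valued integrals *)

Lemma probability_Rintegral_cst (d : measure_display) (R : realType)
    (T : measurableType d) (P : probability T R) (r : R) : \int[P]_t r = r.
Proof.
rewrite Rintegral_cst// (_ : fine _ = 1) ?mulr1//.
exact: (congr1 fine (probability_setT P)).
Qed.

Lemma expectation_Rintegral (d : measure_display) (R : realType)
    (T : measurableType d) (P : probability T R) (f : T -> R) :
  P.-integrable setT (EFin \o f) -> ('E_P[f] = (\int[P]_t f t)%:E)%E.
Proof. by move=> fi; rewrite unlock /Rintegral fineK// integrable_fin_num. Qed.

Lemma Rintegral_sum (d : measure_display) (R : realType) (T : measurableType d)
    (P : probability T R) (I : Type) (s : seq I) (F : I -> T -> R) :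
  (forall i, P.-integrable setT (EFin \o F i)) ->
  P.-integrable setT (EFin \o fun t => \sum_(i <- s) F i t) /\
  \int[P]_t (\sum_(i <- s) F i t) = \sum_(i <- s) \int[P]_t F i t.
Proof.
move=> intF; elim: s => [|i s [IH1 IH2]].
  under [X in EFin \o X]eq_fun do rewrite big_nil.
  under [X in Rintegral _ _ X = _]eq_fun do rewrite big_nil.
  rewrite big_nil; split; first exact: integrable0.
  exact: probability_Rintegral_cst.
under [X in EFin \o X]eq_fun do rewrite big_cons.
under [X in Rintegral _ _ X = _]eq_fun do rewrite big_cons.
rewrite big_cons RintegralD// IH2; split => //.
exact: (integrableD measurableT (intF i) IH1).
Qed.

(** This form is linear in the entries of [K], so a random quadratic form can be integrated entry by
    entry. *)
Lemma vdot_quadE (R : realType) (n : nat) (K : 'M[R]_n) (x : 'cV[R]_n) :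
  vdot x (K *m x) = \sum_(p : 'I_n * 'I_n) (x p.1 0 * x p.2 0) * K p.1 p.2.
Proof.
rewrite vdotE -(pair_bigA _ (fun i j => (x i 0 * x j 0) * K i j)) /=.
apply: eq_bigr => i _; rewrite mxE mulr_sumr; apply: eq_bigr => j _.
by ring.
Qed.

(** * One projection step *)

Section ProjStep.
Variables (R : realType) (m n : nat) (W : 'M[R]_(n, m)) (Z : 'M[R]_m).
Hypotheses (Zsym : Z^T = Z) (Zproj : Z *m (W^T *m W) *m Z = Z).

(** Pythagoras: by [Zproj] the removed part [q] satisfies [<q, q> = <e, q>], so exactly one of the
    two cross terms survives. *)
Lemma proj_quadE (u : 'cV[R]_m) (e := W *m u) :
  vdot (W *m (u - Z *m (W^T *m W) *m u)) (W *m (u - Z *m (W^T *m W) *m u)) =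
  vdot e e - vdot (W^T *m e) (Z *m (W^T *m e)).
Proof.
set g := W^T *m e.
have -> : W *m (u - Z *m (W^T *m W) *m u) = e - W *m (Z *m g).
  by rewrite mulmxBr /g /e !mulmxA.
have WZgE (x : 'cV[R]_n) : vdot x (W *m (Z *m g)) = vdot (W^T *m x) (Z *m g).
  by rewrite vdot_mulr.
rewrite !(vdotDl, vdotDr, vdotNl, vdotNr) (vdotC (W *m _) e) !WZgE -/g.
have -> : vdot (W^T *m (W *m (Z *m g))) (Z *m g) = vdot g (Z *m g).
  rewrite vdot_mulr Zsym vdotC -[in RHS]Zproj !mulmxA.
  by [].
by ring.
Qed.

Lemma proj_quad_ge0 (g : 'cV[R]_m) : 0 <= vdot g (Z *m g).
Proof.
rewrite -Zproj -!mulmxA vdot_mulr Zsym vdot_mulr trmxK.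
exact: vdot_ge0.
Qed.

(** An orthogonal projection does not increase the norm. Here [e] is arbitrary, not only of the form
    [W u]. *)
Lemma proj_quad_le (e : 'cV[R]_n) :
  vdot (W^T *m e) (Z *m (W^T *m e)) <= vdot e e.
Proof.
set g := W^T *m e; set q := W *m (Z *m g).
have : 0 <= vdot (e - q) (e - q) by exact: vdot_ge0.
have qE x : vdot x q = vdot (W^T *m x) (Z *m g) by rewrite /q vdot_mulr.
rewrite !(vdotDl, vdotDr, vdotNl, vdotNr) (vdotC q e) !qE -/g.
have -> : vdot (W^T *m q) (Z *m g) = vdot g (Z *m g).
  by rewrite vdot_mulr Zsym vdotC /q -[in RHS]Zproj !mulmxA.
by lra.
Qed.

End ProjStep.

(** * The random error process and its mean contraction *)

Section Process.
Context (d d' : measure_display) (R : realType) (Omega : measurableType d)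
  (T : measurableType d') (P : probability Omega R) (D : probability T R)
  (S : nat -> {RV P >-> T}) (hS : iid D S).
Variables (m n : nat) (W : 'M[R]_(n, m)) (Z : T -> 'M[R]_m).
Hypotheses (Zsym : forall t, (Z t)^T = Z t)
  (Zproj : forall t, Z t *m (W^T *m W) *m Z t = Z t)
  (Zint : forall i j, D.-integrable setT (fun t => (Z t i j)%:E)).

Let H : 'M[R]_m := \matrix_(i, j) \int[D]_t Z t i j.
Let K : 'M[R]_n := W *m H *m W^T.

Lemma mean_quadE (g : 'cV[R]_m) :
  D.-integrable setT (fun t => (vdot g (Z t *m g))%:E) /\
  vdot g (H *m g) = \int[D]_t vdot g (Z t *m g).
Proof.
have int1 (p : 'I_m * 'I_m) :
    D.-integrable setT (fun t => ((g p.1 0 * g p.2 0) * Z t p.1 p.2)%:E).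
  exact: (integrableZl measurableT _ (Zint p.1 p.2)).
have [h1 h2] := Rintegral_sum (index_enum _) int1.
split.
  by move: h1; congr (D.-integrable _ _); apply/funext => t /=; rewrite vdot_quadE.
rewrite (eq_Rintegral _ (fun t _ => vdot_quadE (Z t) g)) h2 vdot_quadE.
by apply: eq_bigr => p _; rewrite mxE RintegralZl//; exact: Zint.
Qed.

Lemma mean_psd : psd H.
Proof.
split; first by apply/matrixP => i j; rewrite !mxE; apply: eq_Rintegral => t _;
  rewrite -[in LHS]Zsym mxE.
move=> g; have [_ ->] := mean_quadE g; apply: Rintegral_ge0 => t _.
exact: proj_quad_ge0 (Zsym t) (Zproj t) g.
Qed.

Lemma gram_mean_quadE (e : 'cV[R]_n) :
  vdot e (K *m e) = vdot (W^T *m e) (H *m (W^T *m e)).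
Proof. by rewrite /K -!mulmxA vdot_mulr. Qed.

Lemma gram_mean_psd : psd K.
Proof.
have [Hsym Hge0] := mean_psd.
split; first by rewrite /K !trmx_mul trmxK Hsym mulmxA.
by move=> e; rewrite gram_mean_quadE.
Qed.

Lemma gram_mean_le (e : 'cV[R]_n) : vdot e (K *m e) <= vdot e e.
Proof.
rewrite gram_mean_quadE; have [int ->] := mean_quadE (W^T *m e).
rewrite -[leRHS](probability_Rintegral_cst D); apply: le_Rintegral => //.
  exact: finite_measure_integrable_cst.
by move=> t _; exact: proj_quad_le.
Qed.

Hypothesis Hunit : H \in unitmx.

(** If [K v = 0], then [H W^T v = 0] by semidefiniteness of [H], and [W^T v = 0] because [H] is
    invertible. Rank-nullity turns this inclusion of kernels into equality of the row spaces of [K]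
    and [W^T]. *)
Lemma gram_mean_range (u : 'cV[R]_m) : exists z, W *m u = K *m z.
Proof.
have [Hsym _] := mean_psd; have [Ksym _] := gram_mean_psd.
have sub : (K <= W^T)%MS by rewrite /K submxMl.
have ker : (kermx K <= kermx W)%MS.
  apply/rV_subP => v; rewrite !sub_kermx => /eqP vK.
  have Kv : K *m v^T = 0 by rewrite -{1}Ksym -trmx_mul vK trmx0.
  have : H *m (W^T *m v^T) = 0.
    apply: psd_ker mean_psd _; rewrite -gram_mean_quadE Kv.
    by rewrite /vdot mulmx0 mxE.
  move/(congr1 (mulmx (invmx H))); rewrite mulKmx// mulmx0 -trmx_mul.
  by move/(congr1 trmx); rewrite trmxK trmx0 => ->.
have rk : (\rank W^T <= \rank K)%N.
  have := mxrankS ker; rewrite !mxrank_ker mxrank_tr.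
  have := rank_leq_row W; have := rank_leq_row K; lia.
have : (W^T <= K)%MS by rewrite -(geq_leqif (mxrank_leqif_sup sub)).
(* Transposing [W^T = V K] gives [W = K V^T], which provides the witness. *)
case/submxP => V VE; exists (V^T *m u).
by rewrite mulmxA -[in RHS]Ksym -trmx_mul -VE trmxK.
Qed.

Lemma gram_mean_rayleigh (u : 'cV[R]_m) (e := W *m u) :
  lambda_min_pos K * vdot e e <= vdot e (K *m e).
Proof.
have [z ez] := gram_mean_range u.
exact: lambda_min_pos_rayleigh gram_mean_psd ez.
Qed.

(** A nonzero column [e] of [W] gives [lambda |e|^2 <= e^T K e <= |e|^2]. The result makes the
    contraction factor nonnegative. *)
Lemma lambda_min_pos_le1 : W != 0 -> lambda_min_pos K <= 1.
Proof.
move=> W0; have [i Wi0] : exists i, W *m delta_mx i (0 : 'I_1) != 0.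
  apply/existsP; apply: contraNT W0; rewrite negb_exists => /forallP h.
  apply/eqP/matrixP => j i; have := h i; rewrite negbK -colE => /eqP/colP/(_ j).
  by rewrite !mxE.
set e := W *m _ in Wi0.
have e0 : 0 < vdot e e.
  rewrite lt_neqAle vdot_ge0 andbT eq_sym.
  by apply: contra Wi0 => /eqP/vdot_eq0 ->.
rewrite -(ler_pM2r e0) mul1r.
exact: le_trans (gram_mean_rayleigh _) (gram_mean_le _).
Qed.

Variable u0 : 'cV[R]_m.

(** The dual iteration recentred at a maximizer: the recursion for [y^k - ys] has no constant
    term. *)
Fixpoint descent (s : nat -> T) (k : nat) : 'cV[R]_m :=
  if k is k'.+1 then
    descent s k' - Z (s k') *m (W^T *m W) *m descent s k'
  else u0.

Let U k w := descent (S ^~ w) k.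
Let err k w := vdot (W *m U k w) (W *m U k w).

(** Every step removes a nonnegative amount on every path. The resulting deterministic bound is the
    source of integrability for the iterates. *)
Lemma err_le k w : err k w <= vdot (W *m u0) (W *m u0).
Proof.
elim: k => [//|k IH]; apply: le_trans IH; rewrite /err /U /= proj_quadE//.
by rewrite gerBl (proj_quad_ge0 (Zsym _) (Zproj _)).
Qed.

Lemma past_measurable_sample j k (f : T -> R) : (k < j)%N ->
  measurable_fun setT f ->
  measurable_fun [set: past S j] ((fun w => f (S k w)) : past S j -> R).
Proof.
move=> kj mf _ E mE; rewrite setTI; apply: sub_sigma_algebra.
exists (fun i => if i == k then f @^-1` E else setT); split.
  by move=> i; case: ifP => // _; rewrite -[X in measurable X]setTI; exact: mf.
apply/seteqP; split => w /=.
  by move=> Ew i _ /=; case: eqP => // ->.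
by move=> h; have := h k; rewrite /= mem_iota add0n kj eqxx; exact.
Qed.

(** [U k] uses only samples of index below [k]. Keeping [j] separate from [k] lets the induction run
    inside a single sigma-algebra. *)
Lemma past_measurable_descent k j i : (k <= j)%N ->
  measurable_fun [set: past S j] ((fun w => U k w i 0) : past S j -> R).
Proof.
elim: k i => [|k IH] i kj; first exact: measurable_cst.
rewrite /U /=.
under eq_fun do rewrite !mxE.
apply: measurable_funB; first exact: IH (ltnW kj).
apply: measurable_sum => l; apply: measurable_funM; last exact: IH (ltnW kj).
under eq_fun do rewrite mxE.
apply: measurable_sum => q; apply: measurable_funM; last exact: measurable_cst.
apply: (past_measurable_sample (f := fun t => Z t i q)) => //.
by have /integrableP[/measurable_EFinP] := Zint i q.
Qed.

Lemma past_measurable_descent_lin k p (M : 'M[R]_(p, m)) i :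
  measurable_fun [set: past S k] ((fun w => (M *m U k w) i 0) : past S k -> R).
Proof.
under eq_fun do rewrite mxE.
apply: measurable_sum => l; apply: measurable_funM; first exact: measurable_cst.
exact: past_measurable_descent.
Qed.

Lemma err_coord_le k w i :
  `|(W *m U k w) i 0| <= vdot (W *m u0) (W *m u0) + 1.
Proof.
set x := (W *m U k w) i 0; set C := vdot _ _.
have xC : x ^+ 2 <= C.
  apply: le_trans (err_le k w); rewrite /err vdotE (bigD1 i)//= -expr2 lerDl.
  by apply: sumr_ge0 => l _; rewrite -expr2 sqr_ge0.
rewrite -real_normK ?num_real// in xC.
(* From [2|x| <= x^2 + 1]; the [+ 1] in the bound avoids a square root. *)
have := sqr_ge0 (`|x| - 1); have := normr_ge0 x; nra.
Qed.

Lemma dual_coord_le k : exists C, forall w i, `|(W^T *m (W *m U k w)) i 0| <= C.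
Proof.
pose C := \sum_i \sum_j `|W j i| * (vdot (W *m u0) (W *m u0) + 1).
have C1 : 0 <= vdot (W *m u0) (W *m u0) + 1 by rewrite addr_ge0// vdot_ge0.
exists C => w i; rewrite mxE (le_trans (ler_norm_sum _ _ _))// /C (bigD1 i)//=.
rewrite -[leLHS]addr0 lerD//; last first.
  by apply: sumr_ge0 => ? _; apply: sumr_ge0 => ? _; rewrite mulr_ge0.
apply: ler_sum => j _; rewrite normrM mxE ler_wpM2l//.
exact: err_coord_le.
Qed.

Lemma err_integrable k : P.-integrable setT (EFin \o err k).
Proof.
apply: (@bounded_rv_integrable _ _ _ _ _ (vdot (W *m u0) (W *m u0))).
  apply: (past_measurableW (S := S) (k := k)).
  rewrite (_ : err k = fun w => \sum_i (W *m U k w) i 0 * (W *m U k w) i 0).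
    by apply: measurable_sum => i; apply: measurable_funM;
      exact: past_measurable_descent_lin.
  by apply/funext => w; exact: vdotE.
by move=> w; rewrite ger0_norm ?vdot_ge0//; exact: err_le.
Qed.

Lemma coord_integrable k i :
  P.-integrable setT (EFin \o fun w => (W *m U k w) i 0).
Proof.
apply: (@bounded_rv_integrable _ _ _ _ _ (vdot (W *m u0) (W *m u0) + 1)); last first.
  by move=> w; exact: err_coord_le.
apply: (past_measurableW (S := S) (k := k)).
exact: past_measurable_descent_lin.
Qed.

(** Products of two coordinates of [g] are bounded functions of the past, hence independent of the
    fresh sample [S k]. Each term of the expanded form factors, and the entry of [Z (S k)] averages
    to that of [H]. *)
Lemma decrease_integral k (g := fun w => W^T *m (W *m U k w)) :
  [/\ P.-integrable setT (fun w => (vdot (g w) (Z (S k w) *m g w))%:E),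
      P.-integrable setT (fun w => (vdot (g w) (H *m g w))%:E) &
      \int[P]_w vdot (g w) (Z (S k w) *m g w) =
      \int[P]_w vdot (g w) (H *m g w)].
Proof.
have [C gC] := dual_coord_le k.
pose phi (p : 'I_m * 'I_m) w := g w p.1 0 * g w p.2 0.
have mphi p : measurable_fun [set: past S k] (phi p : past S k -> R).
  apply: measurable_funM; rewrite /g; under eq_fun do rewrite mulmxA;
  exact: past_measurable_descent_lin.
have phiC p w : `|phi p w| <= C * C by rewrite normrM ler_pM// gC.
have indep p := past_indep_integral hS (mphi p) (phiC p) (Zint p.1 p.2).
have intphi p : P.-integrable setT (EFin \o phi p).
  exact: bounded_rv_integrable (past_measurableW (mphi p)) (phiC p).
have intH p : P.-integrable setT (EFin \o fun w => phi p w * H p.1 p.2).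
  exact: (integrableZr measurableT _ (intphi p)).
have [Zi Ze] := Rintegral_sum (index_enum _) (fun p => (indep p).1).
have [Hi He] := Rintegral_sum (index_enum _) intH.
split.
- by move: Zi; congr (P.-integrable _ _); apply/funext => w /=; rewrite vdot_quadE.
- by move: Hi; congr (P.-integrable _ _); apply/funext => w /=; rewrite vdot_quadE.
rewrite (eq_Rintegral _ (fun w _ => vdot_quadE (Z (S k w)) (g w))) Ze.
rewrite (eq_Rintegral _ (fun w _ => vdot_quadE H (g w))) He.
apply: eq_bigr => p _; have [_ ->] := indep p.
by rewrite RintegralZr//; congr (_ * _); rewrite mxE.
Qed.

Lemma err_mean_step k :
  \int[P]_w err k.+1 w <= (1 - lambda_min_pos K) * \int[P]_w err k w.
Proof.
have [Zi Hi ZH] := decrease_integral k.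
rewrite (eq_Rintegral _ (fun w _ => proj_quadE (Zsym (S k w)) (Zproj (S k w)) (U k w))).
rewrite RintegralB//; last exact: err_integrable.
rewrite ZH mulrBl mul1r lerD2l lerN2 -RintegralZl//; last exact: err_integrable.
apply: le_Rintegral => //; first exact: (integrableZl measurableT _ (err_integrable k)).
by move=> w _; rewrite -gram_mean_quadE; exact: gram_mean_rayleigh.
Qed.

Lemma err_mean_le k : W != 0 ->
  \int[P]_w err k w <=
  (1 - lambda_min_pos K) ^+ k * vdot (W *m u0) (W *m u0).
Proof.
move=> W0; have rho0 : 0 <= 1 - lambda_min_pos K.
  by rewrite subr_ge0 lambda_min_pos_le1.
elim: k => [|k IH].
  by rewrite expr0 mul1r /err /U /= probability_Rintegral_cst.
by apply: le_trans (err_mean_step k) _; rewrite exprS -mulrA ler_wpM2l.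
Qed.

Lemma inner_integral k (v : 'cV[R]_n) :
  P.-integrable setT (EFin \o fun w => vdot (W *m U k w) v) /\
  \int[P]_w vdot (W *m U k w) v <=
    Num.sqrt (\int[P]_w err k w) * Num.sqrt (vdot v v).
Proof.
set X := Rintegral _ _ _; set E := Rintegral _ _ (err k).
have intX : P.-integrable setT (EFin \o fun w => vdot (W *m U k w) v).
  have [] := @Rintegral_sum _ _ _ P _ (index_enum _)
    (fun i w => (W *m U k w) i 0 * v i 0) _.
    by move=> i; exact: (integrableZr measurableT _ (coord_integrable k i)).
  move=> + _; congr (P.-integrable _ _).
  by apply/funext => w /=; rewrite vdotE.
split=> //.
have E0 : 0 <= E by apply: Rintegral_ge0 => w _; exact: vdot_ge0.
(* The discriminant of t |-> E |t e_k + v|^2 is nonpositive. *)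
pose p := Poly [:: vdot v v; 2 * X; E].
have p0 t : 0 <= p.[t].
  have -> : p.[t] = \int[P]_w vdot (t *: (W *m U k w) + v) (t *: (W *m U k w) + v).
    rewrite horner_Poly /= mul0r add0r.
    have quadE w : vdot (t *: (W *m U k w) + v) (t *: (W *m U k w) + v) =
        t ^+ 2 * err k w + ((2 * t) * vdot (W *m U k w) v + vdot v v).
      rewrite !(vdotDl, vdotDr, vdotZl, vdotZr) (vdotC v) /err; ring.
    have i1 : P.-integrable setT (EFin \o fun w => t ^+ 2 * err k w).
      exact: (integrableZl measurableT _ (err_integrable k)).
    have i2 : P.-integrable setT (EFin \o fun w => (2 * t) * vdot (W *m U k w) v).
      exact: (integrableZl measurableT _ intX).
    have i3 : P.-integrable setT (EFin \o fun=> vdot v v).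
      exact: finite_measure_integrable_cst.
    rewrite (eq_Rintegral _ (fun w _ => quadE w)) RintegralD//; last first.
      exact: (integrableD measurableT i2 i3).
    rewrite RintegralD// !RintegralZl//; last exact: err_integrable.
    rewrite probability_Rintegral_cst -/X -/E; ring.
  by apply: Rintegral_ge0 => w _; exact: vdot_ge0.
have sp : (size p <= 3)%N := size_Poly [:: vdot v v; 2 * X; E].
have := deg_le2_poly_ge0 sp p0.
rewrite !coef_Poly /= => disc.
rewrite -sqrtrM//; apply: le_trans (ler_norm X) _; rewrite -sqrtr_sqr ler_wsqrtr//.
by move: disc; lra.
Qed.

End Process.

(** * The primal-dual pair and the convergence bounds *)

Lemma spd_unitmx (R : realType) (n : nat) (G : 'M[R]_n) : spd G -> G \in unitmx.
Proof.
move=> [Gsym Gpos]; rewrite -row_free_unit -kermx_eq0; apply/eqP/row_matrixP => i.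
rewrite row0; set u := row i _.
have uG : u *m G = 0 by apply/eqP; rewrite -sub_kermx row_sub.
apply/eqP; apply: contraT => u0.
have := Gpos u^T; rewrite trmxK uG mul0mx mxE ltxx; apply.
by rewrite -(inj_eq (@trmx_inj _ _ _)) trmxK trmx0.
Qed.

Lemma normG_sqr (R : realType) (n : nat) (G : 'M[R]_n) (x : 'cV[R]_n) :
  0 <= vdot x (G *m x) -> normG G x ^+ 2 = vdot x (G *m x).
Proof. by move=> h; rewrite /normG -mulmxA sqr_sqrtr. Qed.

Theorem theorem23 (R : realType) (m n : nat)
    (A : 'M[R]_(m, n)) (b : 'cV[R]_m) (B : 'M[R]_n) (c : 'cV[R]_n)
    (hA : A != 0) (hcons : exists x : 'cV[R]_n, A *m x = b) (hB : spd B)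
    (D : probability (rmat R m) R)
    (hHdef : sketch_integrable A B D) (hHns : meanH A B D \in unitmx)
    (d : measure_display) (Omega : measurableType d) (P : probability Omega R)
    (S : nat -> {RV P >-> rmat R m}) (hS : iid D S)
    (y0 : 'cV[R]_m)
    (xs : 'cV[R]_n) (hxs : A *m xs = b)
    (hxs_min : forall x : 'cV[R]_n, A *m x = b -> primal B c xs <= primal B c x)
    (ys : 'cV[R]_m)
    (hys_max : forall y : 'cV[R]_m, dual A b B c y <= dual A b B c ys)
    (Bmh : 'M[R]_n) (hBmh : spd_sqrt (invmx B) Bmh) :
  let Y (k : nat) (w : Omega) : 'cV[R]_m :=
    sda A b B c y0 (fun i => S i w) k in
  let X (k : nat) (w : Omega) : 'cV[R]_n := primal_of A B c (Y k w) in
  let OPT : R := primal B c xs in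
  let U0 : R := 2^-1 * normG B (primal_of A B c y0 - xs) ^+ 2 in
  let rho : R :=
    1 - lambda_min_pos (Bmh *m A^T *m meanH A B D *m A *m Bmh) in
  [/\ OPT = dual A b B c ys,
      U0 = OPT - dual A b B c y0 &
      forall k : nat,
      [/\ ('E_P[fun w => (OPT - dual A b B c (Y k w))%R]
             <= (rho ^+ k * U0)%R%:E)%E,
          ('E_P[fun w => (primal B c (X k w) - OPT)%R]
             <= (rho ^+ k * U0
                 + 2 * rho `^ (k%:R / 2) * Num.sqrt (OPT * U0))%R%:E)%E &
          ('E_P[fun w => (primal B c (X k w) - dual A b B c (Y k w))%R]
             <= (2 * rho ^+ k * U0
                 + 2 * rho `^ (k%:R / 2) * Num.sqrt (OPT * U0))%R%:E)%E]].
Proof.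
move=> Y X OPT U0 rho.
have [BmhS BmhB] := hBmh.
have Bmhsym : Bmh^T = Bmh by case: BmhS.
have Bu := spd_unitmx hB.
pose W := Bmh *m A^T.
have WtE : W^T = A *m Bmh by rewrite trmx_mul trmxK Bmhsym.
have WE : A *m invmx B *m A^T = W^T *m W by rewrite WtE -BmhB !mulmxA.
have iWW y y' : vdot y (W^T *m W *m y') = vdot (W *m y) (W *m y').
  by rewrite -mulmxA vdot_mulr trmxK.
have normAt y : normG (invmx B) (A^T *m y) ^+ 2 = vdot (W *m y) (W *m y).
  have E : vdot (A^T *m y) (invmx B *m (A^T *m y)) = vdot (W *m y) (W *m y).
    by rewrite -iWW -WE -!mulmxA [RHS]vdot_mulr.
  by rewrite normG_sqr E ?vdot_ge0.
have normB y : normG B (invmx B *m A^T *m y) ^+ 2 = vdot (W *m y) (W *m y).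
  have E : vdot (invmx B *m A^T *m y) (B *m (invmx B *m A^T *m y)) =
      vdot (W *m y) (W *m y).
    by rewrite -iWW -WE -!mulmxA mulKVmx// [RHS]vdot_mulr vdotC.
  by rewrite normG_sqr E ?vdot_ge0.
have dualE y : dual A b B c y =
    vdot (b - A *m c) y - 2^-1 * vdot y (W^T *m W *m y).
  by rewrite /dual normAt iWW.
have Wpsd : psd (W^T *m W).
  by split; [rewrite trmx_mul trmxK | move=> x; rewrite iWW vdot_ge0].
have ysE : b - A *m c = W^T *m W *m ys.
  by apply: maximizer_stationary => // y; rewrite -!dualE.
have Aprimal y : A *m primal_of A B c y = A *m c + W^T *m W *m y.
  by rewrite /primal_of mulmxDr -WE !mulmxA.
(* The point [x'] is feasible, and [xs - x'] lies in the kernel of [A], which is [B]-orthogonal to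
   [x' - c]. So [P(xs)] exceeds [P(x')] by half of [|xs - x'|_B^2], and minimality forces
   equality. *)
have xsE : xs = primal_of A B c ys.
  set x' := primal_of A B c ys; pose v := invmx B *m A^T *m ys.
  have Ax' : A *m x' = b by rewrite Aprimal -ysE addrC subrK.
  have Bge0 x : 0 <= vdot x (B *m x).
    have [->|x0] := eqVneq x 0; first by rewrite /vdot mulmx0 mulmx0 mxE.
    by rewrite ltW// /vdot mulmxA; exact: (proj2 hB).
  have x'c : x' - c = v by rewrite /x' /primal_of addrAC subrr add0r.
  have xsc : xs - c = (xs - x') + v by rewrite -x'c addrA subrK.
  have Ad : A *m (xs - x') = 0 by rewrite mulmxBr hxs Ax' subrr.
  apply/eqP; rewrite -subr_eq0; move: (xs - x') xsc Ad => dl xsc Ad.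
  apply: contraT => dl0; have := hxs_min x' Ax'; rewrite /primal x'c xsc.
  have Bv : vdot dl (B *m v) = 0.
    by rewrite /v -mulmxA mulKVmx// vdot_mulr trmxK Ad /vdot trmx0 mul0mx mxE.
  have Bv' : vdot v (B *m dl) = 0 by rewrite vdot_mulr (proj1 hB) vdotC.
  have := proj2 hB _ dl0; rewrite -mulmxA -/(vdot _ _) => Bdl.
  rewrite !normG_sqr// mulmxDr !(vdotDl, vdotDr) Bv Bv'; lra.
have dualWE y : dual A b B c y =
    vdot (W *m ys) (W *m y) - 2^-1 * vdot (W *m y) (W *m y).
  by rewrite dualE ysE iWW vdotC iWW vdotC.
have OPTE : OPT = 2^-1 * vdot (W *m ys) (W *m ys).
  by rewrite /OPT /primal xsE /primal_of addrAC subrr add0r normB.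
have primalE y : primal B c (primal_of A B c y) = 2^-1 * vdot (W *m y) (W *m y).
  by rewrite /primal /primal_of addrAC subrr add0r normB.
have U0E : U0 = 2^-1 * vdot (W *m (y0 - ys)) (W *m (y0 - ys)).
  rewrite /U0 xsE /primal_of opprD addrACA subrr add0r -mulmxBr normB.
  by [].
pose u0 : 'cV[R]_m := y0 - ys.
pose Zs : rmat R m -> 'M[R]_m := sketch A B.
pose U k w := descent W Zs u0 (fun i => S i w) k.
(* By [ysE] the residual at [y] is [- W^T W (y - ys)], so the iteration becomes [descent] started at
   [y0 - ys]. *)
have YE k w : Y k w = ys + U k w.
  rewrite /Y /U; elim: k => [|k IH] /=; first by rewrite addrC subrK.
  rewrite Aprimal opprD addrA ysE -mulmxBr IH opprD addrA subrr add0r.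
  by rewrite !mulmxN !mulmxA addrA.
have dual_gap u : OPT - dual A b B c (ys + u) = 2^-1 * vdot (W *m u) (W *m u).
  rewrite OPTE dualWE mulmxDr !(vdotDl, vdotDr) (vdotC (W *m u)); lra.
have primal_gap u : primal B c (primal_of A B c (ys + u)) - OPT =
    2^-1 * vdot (W *m u) (W *m u) + vdot (W *m u) (W *m ys).
  rewrite OPTE primalE mulmxDr !(vdotDl, vdotDr) (vdotC (W *m ys)); lra.
split.
- rewrite OPTE dualWE; lra.
- by rewrite U0E -dual_gap (addrC ys) subrK.
move=> k.
have Zsym s : (Zs s)^T = Zs s by exact: sketch_sym WE s.
have Zproj s : Zs s *m (W^T *m W) *m Zs s = Zs s by exact: sketch_proj WE s.
have HE : \matrix_(i, j) (\int[D]_t Zs t i j) = meanH A B D.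
  by apply/matrixP => i j; rewrite !mxE unlock.
have Hunit : \matrix_(i, j) (\int[D]_t Zs t i j) \in unitmx by rewrite HE.
have rhoE : rho = 1 - lambda_min_pos
    (W *m (\matrix_(i, j) \int[D]_t Zs t i j) *m W^T).
  by rewrite HE WtE /W !mulmxA.
have W0 : W != 0.
  apply: contra hA => /eqP W0; rewrite -[A]trmxK -(mulKmx (spd_unitmx BmhS) A^T).
  by rewrite -/W W0 mulmx0 trmx0.
have ierr := err_integrable S Zsym Zproj hHdef u0 k.
have [iX Xle] := inner_integral S Zsym Zproj hHdef u0 k (W *m ys).
have Ele := err_mean_le hS Zsym Zproj hHdef Hunit u0 k W0.
(* Nonnegativity allows the real power of [rho] to be read as the square root of [rho ^+ k]. *)
have rho0 : 0 <= rho.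
  by rewrite rhoE subr_ge0; exact: lambda_min_pos_le1.
rewrite -rhoE -/u0 in Ele.
set E := Rintegral _ _ _ in Ele; set X1 := Rintegral _ _ _ in Xle.
rewrite -/E in Xle.
have U0ge0 : 0 <= U0 by rewrite U0E mulr_ge0// vdot_ge0.
have EU0 : 2^-1 * E <= rho ^+ k * U0.
  by move: Ele; rewrite U0E -/u0 mulrCA ler_pM2l// invr_gt0.
(* Here [E <= 2 rho^k U0] and [|W ys|^2 = 2 OPT], so the Cauchy-Schwarz bound is at most the square
   root of [4 rho^k OPT U0]. The factor 2 is written as a root so that everything merges under one
   root. *)
have XU0 : X1 <= 2 * rho `^ (k%:R / 2) * Num.sqrt (OPT * U0).
  apply: le_trans Xle _.
  have -> : rho `^ (k%:R / 2) = Num.sqrt (rho ^+ k).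
    by rewrite powRrM powR_mulrn// powR12_sqrt ?exprn_ge0.
  have -> : vdot (W *m ys) (W *m ys) = 2 * OPT by rewrite OPTE; lra.
  have OPT0 : 0 <= OPT by rewrite OPTE mulr_ge0// vdot_ge0.
  have r4 : 2 = Num.sqrt (2 ^+ 2) :> R by rewrite sqrtr_sqr ger0_norm.
  rewrite -sqrtrM; last exact: Rintegral_ge0 (fun w _ => vdot_ge0 _).
  rewrite {2}r4 -!sqrtrM ?mulr_ge0 ?exprn_ge0 ?sqr_ge0//.
  apply: ler_wsqrtr; move: EU0 OPT0; rewrite expr2 -mulrA; nra.
pose err w := vdot (W *m U k w) (W *m U k w).
have gapE : (fun w => OPT - dual A b B c (Y k w)) = (fun w => 2^-1 * err w).
  by apply/funext => w; rewrite YE dual_gap.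
have pgapE : (fun w => primal B c (X k w) - OPT) =
    (fun w => 2^-1 * err w + vdot (W *m U k w) (W *m ys)).
  by apply/funext => w; rewrite /X YE primal_gap.
(* The duality gap is the sum of the primal and dual gaps, so the third bound adds the first two. *)
have pdE : (fun w => primal B c (X k w) - dual A b B c (Y k w)) =
    (fun w => (2^-1 * err w + vdot (W *m U k w) (W *m ys)) + 2^-1 * err w).
  by apply/funext => w; rewrite /X YE -primal_gap -dual_gap addrA subrK.
have i1 : P.-integrable setT (EFin \o fun w => 2^-1 * err w).
  exact: (integrableZl measurableT _ ierr).
have i2 : P.-integrable setT
    (EFin \o fun w => 2^-1 * err w + vdot (W *m U k w) (W *m ys)).
  exact: (integrableD measurableT i1 iX).
have e1 : \int[P]_w (2^-1 * err w) = 2^-1 * E by rewrite RintegralZl.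
have e2 : \int[P]_w (2^-1 * err w + vdot (W *m U k w) (W *m ys)) = 2^-1 * E + X1.
  by rewrite RintegralD// e1.
split.
- by rewrite gapE expectation_Rintegral// lee_fin e1.
- by rewrite pgapE expectation_Rintegral// lee_fin e2 lerD.
rewrite pdE expectation_Rintegral; last exact: (integrableD measurableT i2 i1).
rewrite lee_fin RintegralD// e1 e2.
by move: EU0 XU0; lra.
Qed.
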